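(* Let $K$ be a commutative unital ring and let $\theta$ be a compatible unital action of an inverse monoid $S$ on a unital associative $K$-algebra $A$. Then there is a surjective algebra homomorphism $\Phi:A\rtimes_\theta S\to A\rtimes_{\tilde\theta}\mathcal G(S)$ sending $a\delta_s+\mathcal N$ to $a\delta_{[s]}$ (for all $s\in S$, $a\in 1_sA$), where $[s]\in\mathcal G(S)$ is the $\sigma$-class of $s$.
   Context: Inverse monoids. For an inverse monoid $S$, $E(S)$ is its set of idempotents and $s\le t$ means $s=et$ for some $e\in E(S)$. The minimum group congruence $\sigma$ on $S$ is: $(s,t)\in\sigma$ iff there is $u\in S$ with $u\le s$ and $u\le t$. $\mathcal G(S)=S/\sigma$ is the maximum group image of $S$; its elements are $\sigma$-classes. Actions. $\mathcal I(A)$ is the symmetric inverse monoid of all bijections between subsets of $A$. A unital action of $S$ on $A$ is a semigroup homomorphism $\theta:S\to\mathcal I(A)$, $s\mapsto\theta_s$, such that the domain and range of each $\theta_s$ are ideals of $A$, $\theta_s$ is an isomorphism of $K$-algebras from its domain onto its range, $\theta_{1_S}=\mathrm{id}_A$, and the range of $\theta_s$ is $1_sA$ for some central idempotent $1_s$ of $A$ (so $\theta_s:1_{s^{-1}}A\to 1_sA$). The action is compatible if for all $(s,t)\in\sigma$ the maps $\theta_s$ and $\theta_t$ agree on the intersection of their domains. Crossed product. $L(A,\theta,S)=\bigoplus_{s\in S}1_sA\,\delta_s$ ($\delta_s$ are symbols) with product $a\delta_s\cdot b\delta_t=a\,\theta_s(1_{s^{-1}}b)\,\delta_{st}$ is an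 associative $K$-algebra; $\mathcal N$ is its ideal generated by all $a\delta_s-a\delta_t$ with $s\le t$ and $a\in 1_sA$; $A\rtimes_\theta S=L(A,\theta,S)/\mathcal N$. Induced partial action and skew group algebra. For $g\in\mathcal G(S)$ let $\mathcal D_g=\sum_{s\in g}1_sA$ and $\tilde\theta_g:\mathcal D_{g^{-1}}\to\mathcal D_g$, $\tilde\theta_g(\sum_{s\in g}a_{s^{-1}})=\sum_{s\in g}\theta_s(a_{s^{-1}})$ with $a_{s^{-1}}\in 1_{s^{-1}}A$ (finite sums); these maps are well defined and form a partial action $\tilde\theta$ of the group $\mathcal G(S)$ on $A$. The skew group algebra is $A\rtimes_{\tilde\theta}\mathcal G(S)=\bigoplus_{g\in\mathcal G(S)}\mathcal D_g\delta_g$ with product $a\delta_g\cdot b\delta_h=\tilde\theta_g(\tilde\theta_g^{-1}(a)b)\delta_{gh}$. *)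

(* Defs.v *)
From HB Require Import structures.
From mathcomp Require Import all_boot all_algebra.
From mathcomp Require Import boolp classical_sets functions cardinality.

Set Implicit Arguments.
Unset Strict Implicit.
Unset Printing Implicit Defensive.

Import GRing.Theory.
Local Open Scope classical_set_scope.
Local Open Scope ring_scope.

Section UniqueInverses.
Local Open Scope group_scope.
Variables (S : monoidType) (inv : S -> S).
Hypothesis inv_pseudo :
  forall s : S, s * inv s * s = s /\ inv s * s * inv s = inv s.
Hypothesis inv_uniq :
  forall s t : S, s * t * s = s -> t * s * t = t -> t = inv s.

Lemma uinvK : involutive inv.
Proof. by move=> s; have [h1 h2] := inv_pseudo s; symmetry; exact: inv_uniq. Qed.

Lemma uinv_idem (e : S) : e * e = e -> inv e = e.
Proof. by move=> ee; symmetry; apply: inv_uniq; rewrite !ee. Qed.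

Lemma uinv_idemM (e f : S) : e * e = e -> f * f = f -> e * f * (e * f) = e * f.
Proof.
move=> ee ff; have [h1 h2] := inv_pseudo (e * f).
set x := inv (e * f) in h1 h2.
have xE : x = f * x * e.
  symmetry; apply: inv_uniq.
    have -> : e * f * (f * x * e) * (e * f) = e * (f * f) * x * (e * e) * f.
      by rewrite !mulgA.
    by rewrite ee ff -[RHS]h1 !mulgA.
  have -> : f * x * e * (e * f) * (f * x * e) =
            f * (x * ((e * e) * (f * f)) * x) * e by rewrite !mulgA.
  by rewrite ee ff h2.
have xx : x * x = x.
  rewrite {1 2}xE.
  have -> : f * x * e * (f * x * e) = f * (x * (e * f) * x) * e by rewrite !mulgA.
  by rewrite h2 -xE.
by have := uinv_idem xx; rewrite /x uinvK -/x => ->.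
Qed.

Lemma uinv_idemC (e f : S) : e * e = e -> f * f = f -> e * f = f * e.
Proof.
move=> ee ff; have h := uinv_idemM ee ff; have h' := uinv_idemM ff ee.
rewrite -[LHS](uinv_idem h); symmetry; apply: inv_uniq.
  have -> : e * f * (f * e) * (e * f) = e * (f * f) * (e * e) * f.
    by rewrite !mulgA.
  by rewrite ee ff -mulgA.
have -> : f * e * (e * f) * (f * e) = f * (e * e) * (f * f) * e.
  by rewrite !mulgA.
by rewrite ee ff -mulgA.
Qed.

Lemma uinvM : {morph inv : s t / s * t >-> t * s}.
Proof.
move=> s t; symmetry; have [s1 s2] := inv_pseudo s; have [t1 t2] := inv_pseudo t.
have es : (inv s * s) * (inv s * s) = inv s * s by rewrite mulgA s2.
have et : (t * inv t) * (t * inv t) = t * inv t by rewrite mulgA t1.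
have C := uinv_idemC es et.
apply: inv_uniq.
  have -> : s * t * (inv t * inv s) * (s * t) =
            s * (t * inv t * (inv s * s)) * t by rewrite !mulgA.
  rewrite -C.
  have -> : s * (inv s * s * (t * inv t)) * t = s * inv s * s * (t * inv t * t).
    by rewrite !mulgA.
  by rewrite s1 t1.
have -> : inv t * inv s * (s * t) * (inv t * inv s) =
          inv t * (inv s * s * (t * inv t)) * inv s by rewrite !mulgA.
rewrite C.
have -> : inv t * (t * inv t * (inv s * s)) * inv s =
          inv t * t * inv t * (inv s * s * inv s) by rewrite !mulgA.
by rewrite s2 t2.
Qed.

End UniqueInverses.

(* StarMonoid provides invgK and invgM, which follow from the uniqueness of
   inverses: the factory Monoid_isInverseMonoid below has only the latter *)
HB.mixin Record StarMonoid_isInverseMonoid S of StarMonoid S := {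
  mulgVg : forall s : S, (s * s^-1 * s)%g = s;
  invg_uniq : forall s t : S,
    (s * t * s)%g = s -> (t * s * t)%g = t -> t = (s^-1)%g
}.

#[short(type="inverseMonoidType")]
HB.structure Definition InverseMonoid :=
  {S of StarMonoid S & StarMonoid_isInverseMonoid S}.

HB.factory Record Monoid_isInverseMonoid S of Monoid S := {
  inv : S -> S;
  inv_pseudo : forall s : S,
    (s * inv s * s)%g = s /\ (inv s * s * inv s)%g = inv s;
  inv_uniq : forall s t : S,
    (s * t * s)%g = s -> (t * s * t)%g = t -> t = inv s
}.

HB.builders Context S of Monoid_isInverseMonoid S.

HB.instance Definition _ := hasInv.Build S inv.
HB.instance Definition _ := Monoid_isStarMonoid.Build S
  (uinvK inv_pseudo inv_uniq) (uinvM inv_pseudo inv_uniq).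
HB.instance Definition _ := StarMonoid_isInverseMonoid.Build S
  (fun s => proj1 (inv_pseudo s)) inv_uniq.

HB.end.

Section InverseMonoidTheory.
Local Open Scope group_scope.
Variable S : inverseMonoidType.
Implicit Types s t u e f : S.

Definition idem e := e * e = e.

(* the natural partial order *)
Definition nle s t := exists2 e, idem e & s = e * t.

(* the minimum group congruence *)
Definition sigma s t := exists2 u, nle u s & nle u t.

Lemma mulVgV s : s^-1 * s * s^-1 = s^-1.
Proof. by have := mulgVg s^-1; rewrite invgK. Qed.

Lemma idem_mulgV s : idem (s * s^-1).
Proof. by rewrite /idem mulgA mulgVg. Qed.

Lemma idem_mulVg s : idem (s^-1 * s).
Proof. by rewrite /idem mulgA mulVgV. Qed.

Lemma inv_pseudo s : s * s^-1 * s = s /\ s^-1 * s * s^-1 = s^-1.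
Proof. by split; [exact: mulgVg | exact: mulVgV]. Qed.

Lemma idemV e : idem e -> e^-1 = e.
Proof. exact: (uinv_idem (@invg_uniq S)). Qed.

Lemma idemM e f : idem e -> idem f -> idem (e * f).
Proof. exact: (uinv_idemM inv_pseudo (@invg_uniq S)). Qed.

Lemma idemC e f : idem e -> idem f -> e * f = f * e.
Proof. exact: (uinv_idemC inv_pseudo (@invg_uniq S)). Qed.

Lemma idem1 : idem 1. Proof. exact: mul1g. Qed.

Lemma idemJ s f : idem f -> s * f = (s * f * s^-1) * s.
Proof.
move=> ff; have -> : s * f * s^-1 * s = s * (f * (s^-1 * s)) by rewrite !mulgA.
by rewrite (idemC ff (idem_mulVg s)) !mulgA mulgVg.
Qed.

Lemma idem_conj s f : idem f -> idem (s * f * s^-1).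
Proof.
move=> ff; rewrite /idem.
have -> : s * f * s^-1 * (s * f * s^-1) = s * (f * (s^-1 * s)) * f * s^-1.
  by rewrite !mulgA.
rewrite (idemC ff (idem_mulVg s)).
have -> : s * (s^-1 * s * f) * f * s^-1 = s * s^-1 * s * (f * f) * s^-1.
  by rewrite !mulgA.
by rewrite mulgVg ff.
Qed.

Lemma nle_refl s : nle s s.
Proof. by exists 1; [exact: idem1 | rewrite mul1g]. Qed.

Lemma nle_idem e s : idem e -> nle (e * s) s.
Proof. by exists e. Qed.

Lemma nleM s s' t t' : nle s s' -> nle t t' -> nle (s * t) (s' * t').
Proof.
move=> [e ee ->] [f ff ->]; exists (e * (s' * f * s'^-1)).
  exact: idemM (idem_conj _ ff).
have -> : e * s' * (f * t') = e * (s' * f) * t' by rewrite !mulgA.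
by rewrite [in LHS](idemJ s' ff) !mulgA.
Qed.

Lemma nleV s t : nle s t -> nle s^-1 t^-1.
Proof.
move=> [e ee ->]; rewrite invgM (idemV ee) (idemJ _ ee).
by apply: nle_idem; apply: idem_conj.
Qed.

Lemma sigma_refl s : sigma s s.
Proof. by exists s; exact: nle_refl. Qed.

Lemma sigma_sym s t : sigma s t -> sigma t s.
Proof. by case=> u us ut; exists u. Qed.

Lemma sigma_trans t s u : sigma s t -> sigma t u -> sigma s u.
Proof.
case=> _ [e ee ->] [f ff e1] [_ [e' ee' ->] [f' ff' e2]].
exists (e' * f * t).
  by exists (e' * e); [exact: idemM | rewrite -!mulgA e1].
exists (f * f'); first exact: idemM.
by rewrite (idemC ee' ff) -!mulgA e2.
Qed.

Lemma sigmaM s s' t t' : sigma s s' -> sigma t t' -> sigma (s * t) (s' * t').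
Proof.
by move=> [u us us'] [v vt vt']; exists (u * v); exact: nleM.
Qed.

Lemma sigmaV s t : sigma s t -> sigma s^-1 t^-1.
Proof. by move=> [u us ut]; exists u^-1; exact: nleV. Qed.

Lemma nle_sigma s t : nle s t -> sigma s t.
Proof. by move=> st; exists s => //; exact: nle_refl. Qed.

Lemma sigma_idem e : idem e -> sigma e 1.
Proof. by move=> ee; apply: nle_sigma; exists e; rewrite ?mulg1. Qed.

Definition sigmab s t : bool := `[< sigma s t >].

Lemma sigmab_equiv : equiv_class_of sigmab.
Proof.
split=> [s|s t|t s u]; first exact/asboolP/sigma_refl.
  by apply/asboolP/asboolP; exact: sigma_sym.
by move=> /asboolP st /asboolP tu; apply/asboolP; exact: sigma_trans tu.
Qed.

Canonical sigma_equiv := EquivRelPack sigmab_equiv.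
Canonical sigma_encModRel := defaultEncModRel sigmab.

End InverseMonoidTheory.

(* The maximum group image: the quotient by sigma; the class of s is \pi s *)
Definition max_group_image (S : inverseMonoidType) : Type := {eq_quot (@sigmab S)}%qT.

HB.instance Definition _ (S : inverseMonoidType) := Choice.on (max_group_image S).
HB.instance Definition _ (S : inverseMonoidType) : EqQuotient S (@sigmab S) (max_group_image S) :=
  EqQuotient.on (max_group_image S).

Definition sigma_class (S : inverseMonoidType) (s : S) : max_group_image S :=
  \pi_(max_group_image S)%qT s.

Section MaxGroupImage.
Local Open Scope group_scope.
Variable S : inverseMonoidType.
Local Notation G := (max_group_image S).
Local Notation "[ s ]" := (@sigma_class S s).

Lemma sigma_classP (s t : S) : [s] = [t] <-> sigma s t.
Proof.
split=> [/eqmodP/asboolP // | st]; exact/eqmodP/asboolP.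
Qed.

Lemma sigma_class_surj (g : G) : exists s, [s] = g.
Proof. by exists (repr g); rewrite /sigma_class reprK. Qed.

Lemma sigma_class_repr (s : S) : sigma (repr [s]) s.
Proof. by apply/sigma_classP; rewrite /sigma_class reprK. Qed.

Definition mgi_mul (g h : G) : G := [repr g * repr h].
Definition mgi_one : G := [1].
Definition mgi_inv (g : G) : G := [(repr g)^-1].

Lemma mgi_mulE s t : mgi_mul [s] [t] = [s * t].
Proof. by apply/sigma_classP/sigmaM; exact: sigma_class_repr. Qed.

Lemma mgi_invE s : mgi_inv [s] = [s^-1].
Proof. by apply/sigma_classP/sigmaV; exact: sigma_class_repr. Qed.

Lemma mgi_mulA : associative mgi_mul.
Proof.
move=> g h k; have [s <-] := sigma_class_surj g; have [t <-] := sigma_class_surj h.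
by have [u <-] := sigma_class_surj k; rewrite !mgi_mulE mulgA.
Qed.

Lemma mgi_mul1 : left_id mgi_one mgi_mul.
Proof. by move=> g; have [s <-] := sigma_class_surj g; rewrite mgi_mulE mul1g. Qed.

Lemma mgi_mulr1 : right_id mgi_one mgi_mul.
Proof. by move=> g; have [s <-] := sigma_class_surj g; rewrite mgi_mulE mulg1. Qed.

Lemma mgi_mulV : left_inverse mgi_one mgi_inv mgi_mul.
Proof.
move=> g; have [s <-] := sigma_class_surj g; rewrite mgi_invE mgi_mulE.
exact/sigma_classP/sigma_idem/idem_mulVg.
Qed.

Lemma mgi_mulrV : right_inverse mgi_one mgi_inv mgi_mul.
Proof.
move=> g; have [s <-] := sigma_class_surj g; rewrite mgi_invE mgi_mulE.
exact/sigma_classP/sigma_idem/idem_mulgV.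
Qed.

HB.instance Definition _ := isGroup.Build G
  mgi_mulA mgi_mul1 mgi_mulr1 mgi_mulV mgi_mulrV.

Lemma sigma_classM s t : [s * t] = [s] * [t].
Proof. by rewrite -[RHS]/(mgi_mul _ _) mgi_mulE. Qed.

Lemma sigma_classV s : [s^-1] = [s]^-1.
Proof. by rewrite -[RHS]/(mgi_inv _) mgi_invE. Qed.

Lemma sigma_class1 : [1] = 1 :> G.
Proof. by []. Qed.

End MaxGroupImage.

(* Partial bijections of A as functions to option A; f x = None means that x is
   outside the domain of f *)
Record pbij (A : Type) := PBij {
  pfun :> A -> option A;
  pfun_inj : forall x y z, pfun x = Some z -> pfun y = Some z -> x = y
}.

HB.instance Definition _ (A : Type) := gen_eqMixin (pbij A).
HB.instance Definition _ (A : Type) := gen_choiceMixin (pbij A).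

Section SymmetricInverseMonoid.
Local Open Scope group_scope.
Variable A : Type.
Implicit Types f g h : pbij A.

Definition pdom f : set A := [set x | exists y, f x = Some y].
Definition pran f : set A := [set y | exists x, f x = Some y].

Lemma pbijP f g : (forall x y, f x = Some y <-> g x = Some y) -> f = g.
Proof.
move=> fg; have {fg} : pfun f = pfun g.
  apply/funext => x; case fx: (f x) => [y|]; first by apply/esym/fg.
  by case gx: (g x) => [y|//]; move/fg: gx; rewrite fx.
case: f g => f fI [g gI] /= fg; subst g; congr PBij; exact: Prop_irrelevance.
Qed.

Lemma pcomp_inj f g x y z :
  obind f (g x) = Some z -> obind f (g y) = Some z -> x = y.
Proof.
case gx: (g x) => [x'|//]; case gy: (g y) => [y'|//] /= fx fy.
by move: gy; rewrite -(pfun_inj fx fy); exact: pfun_inj.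
Qed.

Definition pcomp f g : pbij A := PBij (@pcomp_inj f g).

Lemma pid_inj (x y z : A) : Some x = Some z -> Some y = Some z -> x = y.
Proof. by move=> [->] [->]. Qed.

Definition pid : pbij A := PBij pid_inj.

Definition pinv_fun f (y : A) : option A :=
  if pselect (exists x, f x = Some y) is left h then Some (projT1 (cid h)) else None.

Lemma pinv_funP f x y : pinv_fun f y = Some x <-> f x = Some y.
Proof.
rewrite /pinv_fun; case: pselect => [h|h].
  split=> [[<-]|fx]; first by case: (cid h).
  by congr Some; case: (cid h) => x' /= fx'; exact: pfun_inj fx' fx.
by split=> // fx; case: h; exists x.
Qed.

Lemma pinv_inj f x y z :
  pinv_fun f x = Some z -> pinv_fun f y = Some z -> x = y.
Proof. by move=> /pinv_funP h /pinv_funP; rewrite h => -[]. Qed.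

Definition pinv f : pbij A := PBij (@pinv_inj f).

Lemma pcompP f g x z :
  pcomp f g x = Some z <-> exists2 y, g x = Some y & f y = Some z.
Proof.
rewrite /=; split=> [|[y -> //]].
by case: (g x) => [y|//] /= fy; exists y.
Qed.

Lemma pcompA : associative pcomp.
Proof. by move=> f g h; apply: pbijP => x y /=; case: (h x). Qed.

Lemma pcomp1 : left_id pid pcomp.
Proof. by move=> f; apply: pbijP => x y /=; case: (f x). Qed.

Lemma pcompr1 : right_id pid pcomp.
Proof. by move=> f; apply: pbijP. Qed.

HB.instance Definition _ := isMonoid.Build (pbij A) pcompA pcomp1 pcompr1.

Lemma pinv_pseudo f : f * pinv f * f = f /\ pinv f * f * pinv f = pinv f.
Proof.
split; apply: pbijP => x y; split.
- move=> /pcompP[z fx] /pcompP[w] /pinv_funP fw fwy.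
  by rewrite (pfun_inj fx fw).
- move=> fx; apply/pcompP; exists y => //.
  by apply/pcompP; exists x => //; apply/pinv_funP.
- move=> /pcompP[z /pinv_funP fz] /pcompP[w fzw] /pinv_funP fy.
  by apply/pinv_funP; move: fzw; rewrite fz => -[->].
- move=> h; apply/pcompP; exists y => //.
  by apply/pcompP; exists x => //; apply/pinv_funP.
Qed.

Lemma pseudo_sub f g x y : g * f * g = g -> g y = Some x -> f x = Some y.
Proof.
move=> gfg gy; have := gy; rewrite -[in X in X -> _]gfg.
move=> /pcompP[z]; rewrite gy => -[<-] /pcompP[w fx gw].
by rewrite fx (pfun_inj gy gw).
Qed.

Lemma pinv_uniq f g : f * g * f = f -> g * f * g = g -> g = pinv f.
Proof.
move=> fgf gfg; apply: pbijP => y x; split=> [gy|/pinv_funP fx].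
  by apply/pinv_funP; exact: pseudo_sub gy.
exact: pseudo_sub fx.
Qed.

HB.instance Definition _ :=
  Monoid_isInverseMonoid.Build (pbij A) pinv_pseudo pinv_uniq.

Lemma mul_pbijE f g x : (f * g) x = obind f (g x).
Proof. by []. Qed.

Lemma inv_pbijP f x y : f^-1 y = Some x <-> f x = Some y.
Proof. exact: pinv_funP. Qed.

End SymmetricInverseMonoid.

Lemma gmulfV_inverse (S T : inverseMonoidType) (f : {multiplicative S -> T}) s :
  f s^-1%g = (f s)^-1%g.
Proof. by apply: invg_uniq; rewrite -!gmulfM ?mulgVg ?mulVgV. Qed.

(* Unital associative K-algebras.  algType is not used because it excludes the
   zero algebra *)
Record pzAlgType (K : pzRingType) := PzAlg {
  pzalg_ring : pzRingType;
  pzalg_scale : K -> pzalg_ring -> pzalg_ring;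
  pzalg_scaleA : forall j k x,
    pzalg_scale j (pzalg_scale k x) = pzalg_scale (j * k) x;
  pzalg_scale1 : left_id 1 pzalg_scale;
  pzalg_scaleDr : right_distributive pzalg_scale +%R;
  pzalg_scaleDl : forall x, {morph pzalg_scale^~ x : j k / j + k};
  pzalg_scaleAl : forall k x y, pzalg_scale k (x * y) = pzalg_scale k x * y;
  pzalg_scaleAr : forall k x y, pzalg_scale k (x * y) = x * pzalg_scale k y
}.

Definition pzalg_sort (K : pzRingType) (A : pzAlgType K) : Type := pzalg_ring A.
Coercion pzalg_sort : pzAlgType >-> Sortclass.

HB.instance Definition _ (K : pzRingType) (A : pzAlgType K) :=
  GRing.PzRing.copy (pzalg_sort A) (pzalg_ring A).
HB.instance Definition _ (K : pzRingType) (A : pzAlgType K) :=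
  GRing.Zmodule_isLmodule.Build K (pzalg_sort A) (@pzalg_scaleA K A)
    (@pzalg_scale1 K A) (@pzalg_scaleDr K A) (@pzalg_scaleDl K A).

Definition pzAlg_of_algType (K : pzRingType) (A : algType K) : pzAlgType K :=
  @PzAlg K A _ (@scalerA K A) (@scale1r K A) (@scalerDr K A)
    (fun x j k => scalerDl x j k) (@scalerAl K A) (@scalerAr K A).

Section PzAlgTheory.
Variables (K : pzRingType) (A : pzAlgType K).
Implicit Types (k : K) (x y : A).

Lemma pzscalerAl k x y : k *: (x * y) = (k *: x) * y.
Proof. exact: pzalg_scaleAl. Qed.

Lemma pzscalerAr k x y : k *: (x * y) = x * (k *: y).
Proof. exact: pzalg_scaleAr. Qed.

Definition twosided_ideal (I : set A) :=
  [/\ I 0, (forall x y, I x -> I y -> I (x - y)) &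
      forall a x, I x -> I (a * x) /\ I (x * a)].

(* As A is unital, ideals are K-submodules *)
Lemma twosided_idealZ (I : set A) k x : twosided_ideal I -> I x -> I (k *: x).
Proof.
case=> _ _ h Ix; pose a : A := k *: (1 : A).
by have [+ _] := h a x Ix; rewrite -[a * x]pzscalerAl mul1r.
Qed.

Definition ideal_gen (X : set A) : set A := smallest twosided_ideal X.

Lemma ideal_gen_ideal X : twosided_ideal (ideal_gen X).
Proof.
split=> [I [[]] // | x y Ix Iy I IP | a x Ix].
  by case: (IP) => -[_ h _] _; apply: h; [exact: Ix | exact: Iy].
by split=> I IP; case: (IP) => -[_ _ h] _; have [] := h a x (Ix I IP).
Qed.

Definition ideal_pred (X : set A) : {pred A} := fun x => `[< ideal_gen X x >].

Lemma ideal_predP X x : reflect (ideal_gen X x) (x \in ideal_pred X).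
Proof. exact: asboolP. Qed.

Lemma ideal_pred_closed X : zmod_closed (ideal_pred X).
Proof.
have [h0 hB _] := ideal_gen_ideal X; split; first exact/ideal_predP.
by move=> x y /ideal_predP Ix /ideal_predP Iy; apply/ideal_predP; exact: hB.
Qed.

HB.instance Definition _ X :=
  GRing.isZmodClosed.Build A (ideal_pred X) (ideal_pred_closed X).

End PzAlgTheory.

Section QuotientAlgebra.
Variables (K : pzRingType) (A : pzAlgType K) (X : set A).

Definition quot_ring : Type := Quotient.quot (ideal_pred X).

HB.instance Definition _ := GRing.Zmodule.on quot_ring.

Definition quot_pi (x : A) : quot_ring := (\pi_(Quotient.quot (ideal_pred X)) x)%qT.
Definition quot_repr (x : quot_ring) : A := repr (x : Quotient.quot (ideal_pred X)).

Lemma quot_reprK x : quot_pi (quot_repr x) = x.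
Proof. exact: reprK. Qed.

Lemma quot_piP x y : quot_pi x = quot_pi y <-> ideal_gen X (x - y).
Proof.
split=> [xy|/ideal_predP]; last by rewrite Quotient.idealrBE => /eqP.
by apply/ideal_predP; rewrite Quotient.idealrBE; apply/eqP.
Qed.

Lemma quot_piD : {morph quot_pi : x y / x + y}.
Proof. by move=> x y; rewrite /quot_pi Quotient.pi_add. Qed.

Definition quot_mul (x y : quot_ring) := quot_pi (quot_repr x * quot_repr y).
Definition quot_one := quot_pi 1.
Definition quot_scale (k : K) (x : quot_ring) := quot_pi (k *: quot_repr x).

Lemma quot_repr_sub x : ideal_gen X (quot_repr (quot_pi x) - x).
Proof. by apply/quot_piP; rewrite quot_reprK. Qed.

Lemma quot_piM x y : quot_mul (quot_pi x) (quot_pi y) = quot_pi (x * y).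
Proof.
have [h0 hB hM] := ideal_gen_ideal X.
apply/quot_piP; set x' := quot_repr (quot_pi x); set y' := quot_repr (quot_pi y).
have -> : x' * y' - x * y = x' * (y' - y) - (- (x' - x)) * y.
  by rewrite mulrBr mulNr opprK mulrBl addrA subrK.
apply: (hB); first by have [] := hM x' _ (quot_repr_sub y).
apply: (hM y _ _).2; rewrite -sub0r; apply: (hB) => //.
exact: quot_repr_sub.
Qed.

Lemma quot_piZ k x : quot_scale k (quot_pi x) = quot_pi (k *: x).
Proof.
apply/quot_piP; rewrite -scalerBr.
by apply: (twosided_idealZ _ (ideal_gen_ideal X)); exact: quot_repr_sub.
Qed.

Lemma quot_piS (x : quot_ring) : exists y, quot_pi y = x.
Proof. by exists (quot_repr x); exact: quot_reprK. Qed.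

Lemma quot_mulA : associative quot_mul.
Proof.
move=> x y z; have [x' <-] := quot_piS x; have [y' <-] := quot_piS y.
by have [z' <-] := quot_piS z; rewrite !quot_piM mulrA.
Qed.
Lemma quot_mul1 : left_id quot_one quot_mul.
Proof. by move=> x; have [x' <-] := quot_piS x; rewrite quot_piM mul1r. Qed.
Lemma quot_mulr1 : right_id quot_one quot_mul.
Proof. by move=> x; have [x' <-] := quot_piS x; rewrite quot_piM mulr1. Qed.
Lemma quot_mulDl : left_distributive quot_mul +%R.
Proof.
move=> x y z; have [x' <-] := quot_piS x; have [y' <-] := quot_piS y.
by have [z' <-] := quot_piS z; rewrite -quot_piD !quot_piM -quot_piD mulrDl.
Qed.
Lemma quot_mulDr : right_distributive quot_mul +%R.
Proof.
move=> x y z; have [x' <-] := quot_piS x; have [y' <-] := quot_piS y.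
by have [z' <-] := quot_piS z; rewrite -quot_piD !quot_piM -quot_piD mulrDr.
Qed.

HB.instance Definition _ := GRing.Zmodule_isPzRing.Build quot_ring
  quot_mulA quot_mul1 quot_mulr1 quot_mulDl quot_mulDr.

Lemma quot_scaleA j k x : quot_scale j (quot_scale k x) = quot_scale (j * k) x.
Proof. by have [x' <-] := quot_piS x; rewrite !quot_piZ scalerA. Qed.
Lemma quot_scale1 : left_id 1 quot_scale.
Proof. by move=> x; have [x' <-] := quot_piS x; rewrite !quot_piZ scale1r. Qed.
Lemma quot_scaleDr : right_distributive quot_scale +%R.
Proof.
move=> k x y; have [x' <-] := quot_piS x; have [y' <-] := quot_piS y.
by rewrite -quot_piD !quot_piZ -quot_piD scalerDr.
Qed.
Lemma quot_scaleDl x : {morph quot_scale^~ x : j k / j + k}.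
Proof.
by move=> j k; have [x' <-] := quot_piS x; rewrite !quot_piZ -quot_piD scalerDl.
Qed.
Lemma quot_scaleAl k (x y : quot_ring) : quot_scale k (x * y) = quot_scale k x * y.
Proof.
have [x' <-] := quot_piS x; have [y' <-] := quot_piS y.
by rewrite quot_piZ /GRing.mul /= !quot_piM quot_piZ pzscalerAl.
Qed.
Lemma quot_scaleAr k (x y : quot_ring) : quot_scale k (x * y) = x * quot_scale k y.
Proof.
have [x' <-] := quot_piS x; have [y' <-] := quot_piS y.
by rewrite quot_piZ /GRing.mul /= !quot_piM quot_piZ pzscalerAr.
Qed.

Definition quot_alg : pzAlgType K :=
  PzAlg quot_scaleA quot_scale1 quot_scaleDr quot_scaleDl quot_scaleAl quot_scaleAr.

End QuotientAlgebra.

(* Data for a ring structure on the direct sum of the K-submodules gcomp m of A,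
   m in M: the product of a in gcomp m and b in gcomp n is gmul m n a b in
   gcomp (m * n) and the unit is gone in gcomp 1 *)
Record gradedSystem (K : pzRingType) (A : lmodType K) (M : monoidType) :=
  GradedSystem {
  gcomp : M -> set A;
  gmul : M -> M -> A -> A -> A;
  gone : A;
  gcomp0 : forall m, gcomp m 0;
  gcompP : forall m k a b, gcomp m a -> gcomp m b -> gcomp m (k *: a + b);
  gcomp_mul : forall m n a b,
    gcomp m a -> gcomp n b -> gcomp (m * n)%g (gmul m n a b);
  gmulPl : forall m n k a a' b, gcomp m a -> gcomp m a' -> gcomp n b ->
    gmul m n (k *: a + a') b = k *: gmul m n a b + gmul m n a' b;
  gmulPr : forall m n k a b b', gcomp m a -> gcomp n b -> gcomp n b' ->
    gmul m n a (k *: b + b') = k *: gmul m n a b + gmul m n a b';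
  gmulA : forall m n p a b c, gcomp m a -> gcomp n b -> gcomp p c ->
    gmul m (n * p)%g a (gmul n p b c) = gmul (m * n)%g p (gmul m n a b) c;
  gcomp_one : gcomp 1%g gone;
  gmul1l : forall m a, gcomp m a -> gmul 1%g m gone a = a;
  gmul1r : forall m a, gcomp m a -> gmul m 1%g a gone = a
}.

Section GradedAlgebra.
Variables (K : pzRingType) (A : lmodType K) (M : monoidType).
Variable D : gradedSystem A M.

Definition graded_pred : {pred M -> A} :=
  fun f => `[< finite_set [set m | f m <> 0] /\ forall m, gcomp D m (f m) >].

Lemma graded_predP f : reflect
  (finite_set [set m | f m <> 0] /\ forall m, gcomp D m (f m))
  (f \in graded_pred).
Proof. exact: asboolP. Qed.

Lemma graded_pred_closed : submod_closed graded_pred.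
Proof.
split=> [|k f g /graded_predP[ff fD] /graded_predP[fg gD]]; apply/graded_predP.
  split=> [|m]; last exact: gcomp0.
  by rewrite (_ : [set m | _] = set0) // -subset0 => m.
split=> [|m]; last exact: gcompP.
apply: (@sub_finite_set _ _ ([set m | f m <> 0] `|` [set m | g m <> 0])).
  move=> m /= h; have [fm|] := pselect (f m = 0); last by left.
  right=> gm; apply: h.
  by rewrite -[LHS]/(k *: f m + g m) fm gm scaler0 addr0.
by rewrite finite_setU.
Qed.

HB.instance Definition _ :=
  GRing.isSubmodClosed.Build K (M -> A) graded_pred graded_pred_closed.

(* The direct sum of the gcomp D m, as finitely supported families *)
Record gradedAlg := GradedAlg {
  gcoef :> M -> A;
  _ : gcoef \in graded_pred
}.

HB.instance Definition _ := [isSub for gcoef].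
HB.instance Definition _ := [Choice of gradedAlg by <:].
HB.instance Definition _ :=
  [SubChoice_isSubLmodule of gradedAlg by <:].

Implicit Types (x y z : gradedAlg) (m n p : M) (a b c : A).

Lemma gcoef_comp x m : gcomp D m (x m).
Proof. by have /graded_predP[_] := valP x. Qed.

Lemma gcoef_fin x : finite_set [set m | x m <> 0].
Proof. by have /graded_predP[] := valP x. Qed.

Lemma gcoefP x y : (forall m, x m = y m) -> x = y.
Proof. by move=> xy; apply: val_inj; apply/funext. Qed.

Lemma gcoefD x y m : (x + y) m = x m + y m.
Proof. by []. Qed.

Lemma gcoefZ k x m : (k *: x) m = k *: x m.
Proof. by []. Qed.

Lemma gcoef0 m : (0 : gradedAlg) m = 0.
Proof. by []. Qed.

Definition gsingle m a : M -> A := fun n => if n == m then a else 0.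

Lemma gsingle_graded m a : gcomp D m a -> gsingle m a \in graded_pred.
Proof.
move=> Da; apply/graded_predP; split=> [|n].
  apply: (@sub_finite_set _ _ [set m]); last exact: finite_set1.
  by move=> n /=; rewrite /gsingle; case: eqP.
by rewrite /gsingle; case: eqP => [->|_] //; exact: gcomp0.
Qed.

(* The element a delta_m of the direct sum; it is 0 if a is not in gcomp D m *)
Definition gdelta m a : gradedAlg :=
  if pselect (gcomp D m a) is left h then GradedAlg (gsingle_graded h) else 0.

Lemma gdeltaE m a n : gcomp D m a -> gdelta m a n = if n == m then a else 0.
Proof. by rewrite /gdelta; case: pselect. Qed.

Lemma gdeltaP m k a b : gcomp D m a -> gcomp D m b ->
  gdelta m (k *: a + b) = k *: gdelta m a + gdelta m b.
Proof.
move=> Da Db; apply: gcoefP => n; rewrite gcoefD gcoefZ !gdeltaE //.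
  by case: eqP => // _; rewrite scaler0 addr0.
exact: gcompP.
Qed.

Lemma gdelta0 m : gdelta m 0 = 0.
Proof.
apply: gcoefP => n; rewrite gdeltaE; last exact: gcomp0.
by rewrite if_same.
Qed.

Definition gsupp x : seq M := finmap.enum_fset (fset_set [set m | x m <> 0]).

Lemma gsupp_uniq x : uniq (gsupp x).
Proof. exact: finmap.fset_uniq. Qed.

Lemma gsupp_in x m : m \in gsupp x <-> x m <> 0.
Proof. by rewrite (in_fset_set (gcoef_fin x)) inE. Qed.

Lemma gsuppP x m : m \notin gsupp x -> x m = 0.
Proof. by move/negP => h; apply: contrapT => xm; apply/h/gsupp_in. Qed.

(* sums over the support may be taken over any larger duplicate-free list *)
Lemma gsupp_sum (V : zmodType) (F : M -> A -> V) x (r : seq M) :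
  uniq r -> {subset gsupp x <= r} -> (forall m, F m 0 = 0) ->
  \sum_(m <- gsupp x) F m (x m) = \sum_(m <- r) F m (x m).
Proof.
move=> ur sr F0; rewrite [RHS](bigID (mem (gsupp x))) /=.
rewrite [X in _ + X]big1 ?addr0 => [|m /gsuppP ->]; last exact: F0.
rewrite -[RHS]big_filter; apply: perm_big; apply: uniq_perm.
- exact: gsupp_uniq.
- exact: filter_uniq.
by move=> m; rewrite mem_filter; case: (boolP (m \in gsupp x)) => //= /sr ->.
Qed.

Definition gdmul m n a b : gradedAlg := gdelta (m * n)%g (gmul D m n a b).

Definition galg_mul x y : gradedAlg :=
  \sum_(m <- gsupp x) \sum_(n <- gsupp y) gdmul m n (x m) (y n).

Definition galg_one : gradedAlg := gdelta 1%g (gone D).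

Lemma gdmulPl m n k a a' b : gcomp D m a -> gcomp D m a' -> gcomp D n b ->
  gdmul m n (k *: a + a') b = k *: gdmul m n a b + gdmul m n a' b.
Proof.
by move=> Da Da' Db; rewrite /gdmul gmulPl // gdeltaP //; exact: gcomp_mul.
Qed.

Lemma gdmulPr m n k a b b' : gcomp D m a -> gcomp D n b -> gcomp D n b' ->
  gdmul m n a (k *: b + b') = k *: gdmul m n a b + gdmul m n a b'.
Proof.
by move=> Da Db Db'; rewrite /gdmul gmulPr // gdeltaP //; exact: gcomp_mul.
Qed.

Lemma gdmul0l m n b : gcomp D n b -> gdmul m n 0 b = 0.
Proof.
move=> Db; have D0 := gcomp0 D m; have := gdmulPl (- 1) D0 D0 Db.
by rewrite scaler0 addr0 scaleN1r addNr.
Qed.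

Lemma gdmul0r m n a : gcomp D m a -> gdmul m n a 0 = 0.
Proof.
move=> Da; have D0 := gcomp0 D n; have := gdmulPr (- 1) Da D0 D0.
by rewrite scaler0 addr0 scaleN1r addNr.
Qed.

Lemma galg_mulE (r r' : seq M) x y : uniq r -> {subset gsupp x <= r} ->
  uniq r' -> {subset gsupp y <= r'} ->
  galg_mul x y = \sum_(m <- r) \sum_(n <- r') gdmul m n (x m) (y n).
Proof.
move=> ur sr ur' sr'; rewrite /galg_mul.
rewrite (gsupp_sum (F := fun m a => \sum_(n <- gsupp y) gdmul m n a (y n)) ur sr).
  apply: eq_bigr => m _.
  pose F n b := if pselect (gcomp D n b) then gdmul m n (x m) b else 0.
  have FE n : gdmul m n (x m) (y n) = F n (y n).
    by rewrite /F; case: pselect => // -[]; exact: gcoef_comp.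
  under eq_bigr do rewrite FE; under [RHS]eq_bigr do rewrite FE.
  apply: gsupp_sum => // n; rewrite /F; case: pselect => //= _.
  by apply: gdmul0r; exact: gcoef_comp.
by move=> m; apply: big1 => n _; apply: gdmul0l; exact: gcoef_comp.
Qed.

Lemma galg_mulPl k x y z :
  galg_mul (k *: x + y) z = k *: galg_mul x z + galg_mul y z.
Proof.
pose r := undup (gsupp x ++ gsupp y ++ gsupp (k *: x + y)).
have ur : uniq r by exact: undup_uniq.
have uz := gsupp_uniq z; have sz : {subset gsupp z <= gsupp z} by [].
have s1 : {subset gsupp x <= r} by move=> m; rewrite mem_undup mem_cat => ->.
have s2 : {subset gsupp y <= r}.
  by move=> m; rewrite mem_undup !mem_cat => ->; rewrite orbT.
have s3 : {subset gsupp (k *: x + y) <= r}.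
  by move=> m; rewrite mem_undup !mem_cat => ->; rewrite !orbT.
rewrite (galg_mulE ur s1 uz sz) (galg_mulE ur s2 uz sz) (galg_mulE ur s3 uz sz).
rewrite scaler_sumr -big_split; apply: eq_bigr => m _.
rewrite scaler_sumr -big_split; apply: eq_bigr => n _.
by rewrite gcoefD gcoefZ gdmulPl; try exact: gcoef_comp.
Qed.

Lemma galg_mulPr k x y z :
  galg_mul x (k *: y + z) = k *: galg_mul x y + galg_mul x z.
Proof.
pose r := undup (gsupp y ++ gsupp z ++ gsupp (k *: y + z)).
have ur : uniq r by exact: undup_uniq.
have ux := gsupp_uniq x; have sx : {subset gsupp x <= gsupp x} by [].
have s1 : {subset gsupp y <= r} by move=> m; rewrite mem_undup mem_cat => ->.
have s2 : {subset gsupp z <= r}.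
  by move=> m; rewrite mem_undup !mem_cat => ->; rewrite orbT.
have s3 : {subset gsupp (k *: y + z) <= r}.
  by move=> m; rewrite mem_undup !mem_cat => ->; rewrite !orbT.
rewrite (galg_mulE ux sx ur s1) (galg_mulE ux sx ur s2) (galg_mulE ux sx ur s3).
rewrite scaler_sumr -big_split; apply: eq_bigr => m _.
rewrite scaler_sumr -big_split; apply: eq_bigr => n _.
by rewrite gcoefD gcoefZ gdmulPr; try exact: gcoef_comp.
Qed.

Lemma galg_mulDl : left_distributive galg_mul +%R.
Proof. by move=> x y z; have := galg_mulPl 1 x y z; rewrite !scale1r. Qed.

Lemma galg_mulDr : right_distributive galg_mul +%R.
Proof. by move=> x y z; have := galg_mulPr 1 x y z; rewrite !scale1r. Qed.

Lemma galg_mul0l x : galg_mul 0 x = 0.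
Proof.
by have := galg_mulPl (- 1) 0 0 x; rewrite scaler0 addr0 scaleN1r addNr.
Qed.

Lemma galg_mul0r x : galg_mul x 0 = 0.
Proof.
by have := galg_mulPr (- 1) x 0 0; rewrite scaler0 addr0 scaleN1r addNr.
Qed.

Lemma galg_scaleAl k x y : k *: galg_mul x y = galg_mul (k *: x) y.
Proof. by have := galg_mulPl k x 0 y; rewrite galg_mul0l !addr0. Qed.

Lemma galg_scaleAr k x y : k *: galg_mul x y = galg_mul x (k *: y).
Proof. by have := galg_mulPr k x y 0; rewrite galg_mul0r !addr0. Qed.

Lemma gsupp_delta m a : gcomp D m a -> {subset gsupp (gdelta m a) <= [:: m]}.
Proof.
by move=> Da n /gsupp_in; rewrite gdeltaE // inE; case: eqP.
Qed.

Lemma gdelta_mul m n a b : gcomp D m a -> gcomp D n b ->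
  galg_mul (gdelta m a) (gdelta n b) = gdelta (m * n)%g (gmul D m n a b).
Proof.
move=> Da Db.
rewrite (galg_mulE _ (gsupp_delta Da) _ (gsupp_delta Db)) // !big_seq1.
by rewrite !gdeltaE // !eqxx.
Qed.

Lemma gdelta_sum x : x = \sum_(m <- gsupp x) gdelta m (x m).
Proof.
apply: gcoefP => n.
have -> (r : seq M) : (\sum_(m <- r) gdelta m (x m)) n =
                      \sum_(m <- r) gdelta m (x m) n.
  by elim: r => [|m r IH]; rewrite ?big_nil ?big_cons // gcoefD IH.
under eq_bigr => m _ do rewrite (gdeltaE _ (gcoef_comp x m)).
rewrite -big_mkcond /=; have [nx|nx] := boolP (n \in gsupp x).
  rewrite -big_filter (perm_big [:: n]) ?big_seq1 //.
  apply: uniq_perm => //; first exact/filter_uniq/gsupp_uniq.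
  by move=> m; rewrite mem_filter inE eq_sym; case: eqP => // ->.
by rewrite (gsuppP nx) big1_seq // => m /andP[/eqP <- _]; exact: gsuppP.
Qed.

Lemma galg_ind (P : gradedAlg -> Prop) :
  P 0 -> (forall x y, P x -> P y -> P (x + y)) ->
  (forall m a, gcomp D m a -> P (gdelta m a)) -> forall x, P x.
Proof.
move=> P0 PD Pd x; rewrite (gdelta_sum x); apply: (big_ind P) => // m _.
by apply: Pd; exact: gcoef_comp.
Qed.

Lemma galg_mulA : associative galg_mul.
Proof.
move=> x y z; elim/galg_ind: x => [|x x' h h'|m a Da].
- by rewrite !galg_mul0l.
- by rewrite !galg_mulDl h h'.
elim/galg_ind: y => [|y y' h h'|n b Db].
- by rewrite galg_mul0l !galg_mul0r galg_mul0l.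
- by rewrite !(galg_mulDl, galg_mulDr) h h'.
elim/galg_ind: z => [|z z' h h'|p c Dc].
- by rewrite !galg_mul0r.
- by rewrite !galg_mulDr h h'.
rewrite !gdelta_mul //; try exact: gcomp_mul.
by rewrite gmulA // mulgA.
Qed.

Lemma galg_mul1 : left_id galg_one galg_mul.
Proof.
move=> x; elim/galg_ind: x => [|x x' h h'|m a Da].
- by rewrite galg_mul0r.
- by rewrite galg_mulDr h h'.
by rewrite gdelta_mul ?gmul1l ?mul1g //; exact: gcomp_one.
Qed.

Lemma galg_mulr1 : right_id galg_one galg_mul.
Proof.
move=> x; elim/galg_ind: x => [|x x' h h'|m a Da].
- by rewrite galg_mul0l.
- by rewrite galg_mulDl h h'.
by rewrite gdelta_mul ?gmul1r ?mulg1 //; exact: gcomp_one.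
Qed.

HB.instance Definition _ := GRing.Zmodule_isPzRing.Build gradedAlg
  galg_mulA galg_mul1 galg_mulr1 galg_mulDl galg_mulDr.

Definition graded_alg : pzAlgType K :=
  @PzAlg K gradedAlg _ (@scalerA K gradedAlg) (@scale1r K gradedAlg)
    (@scalerDr K gradedAlg) (fun x j k => scalerDl x j k)
    galg_scaleAl galg_scaleAr.

End GradedAlgebra.

(* uidem s is the central idempotent 1_s of A, which is determined by the range
   1_s A of theta_s.  A bijection between 1_(s^-1) A and 1_s A that is K-linear
   and multiplicative maps the unit of the first to that of the second, so by
   act_linear and act_mul theta_s is an isomorphism of K-algebras *)
Record unital_action (K : pzRingType) (A : pzAlgType K) (S : inverseMonoidType) :=
  UnitalAction {
  act :> {multiplicative S -> pbij A};
  uidem : S -> A;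
  act_dom_ideal : forall s, twosided_ideal (pdom (act s));
  act_ran_ideal : forall s, twosided_ideal (pran (act s));
  act_linear : forall s k x y x' y', act s x = Some x' -> act s y = Some y' ->
    act s (k *: x + y) = Some (k *: x' + y');
  act_mul : forall s x y x' y', act s x = Some x' -> act s y = Some y' ->
    act s (x * y) = Some (x' * y');
  act_one : act 1%g = 1%g;
  uidem_idem : forall s, uidem s * uidem s = uidem s;
  uidemC : forall s x, uidem s * x = x * uidem s;
  act_ran : forall s, pran (act s) = [set uidem s * x | x in [set: A]]
}.

Section CrossedProduct.
Variables (K : pzRingType) (A : pzAlgType K) (S : inverseMonoidType).
Variable theta : unital_action A S.
Local Notation "1_ s" := (uidem theta s) (at level 2, s at level 1, format "1_ s").
Implicit Types (s t : S) (a b c x y : A).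

Definition compatible_action := forall s t, sigma s t ->
  forall x y z, theta s x = Some y -> theta t x = Some z -> y = z.

(* the ideal 1_s A *)
Definition ucomp s : set A := [set 1_ s * x | x in [set: A]].

(* theta_s x, for x in the domain of theta_s; 0 for other x *)
Definition act_app s x : A := odflt 0 (theta s x).

(* theta_s (1_(s^-1) x), for any x in A *)
Definition act_cut s x : A := act_app s (1_ (s^-1)%g * x).

Lemma ucompP s a : ucomp s a <-> 1_ s * a = a.
Proof.
split=> [[x _ <-]|<-]; last by exists a.
by rewrite mulrA uidem_idem.
Qed.

Lemma ucomp0 s : ucomp s 0.
Proof. by apply/ucompP; rewrite mulr0. Qed.

Lemma ucomp_lin s k a b : ucomp s a -> ucomp s b -> ucomp s (k *: a + b).
Proof.
move=> /ucompP sa /ucompP sb; apply/ucompP.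
by rewrite mulrDr -pzscalerAr sa sb.
Qed.

Lemma ucomp_mulr s a b : ucomp s a -> ucomp s (a * b).
Proof. by move=> /ucompP sa; apply/ucompP; rewrite mulrA sa. Qed.

Lemma ucomp_mull s a b : ucomp s a -> ucomp s (b * a).
Proof. by move=> /ucompP sa; apply/ucompP; rewrite mulrA uidemC -mulrA sa. Qed.

Lemma act_domE s : pdom (theta s) = ucomp (s^-1)%g.
Proof.
rewrite /ucomp -act_ran; apply/seteqP; split=> x [y].
  by move=> xy; exists y; rewrite gmulfV_inverse; apply/inv_pbijP.
by rewrite gmulfV_inverse => /inv_pbijP xy; exists y.
Qed.

Lemma act_appE s x : ucomp (s^-1)%g x -> theta s x = Some (act_app s x).
Proof. by rewrite -act_domE => -[y xy]; rewrite /act_app xy. Qed.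

Lemma act_cutE s x : theta s (1_ (s^-1)%g * x) = Some (act_cut s x).
Proof. by rewrite act_appE //; exists x. Qed.

Lemma act_cut_id s x : ucomp (s^-1)%g x -> act_cut s x = act_app s x.
Proof. by move=> /ucompP sx; rewrite /act_cut sx. Qed.

Lemma act_some s x y : theta s x = Some y -> 1_ (s^-1)%g * x = x /\ 1_ s * y = y.
Proof.
move=> xy; split; apply/ucompP; first by rewrite -act_domE; exists y.
by rewrite /ucomp -act_ran; exists x.
Qed.

Lemma act_cutP s x y : theta s (1_ (s^-1)%g * x) = Some y -> act_cut s x = y.
Proof. by rewrite act_cutE => -[]. Qed.

Lemma act_cut_lin s k x y : act_cut s (k *: x + y) = k *: act_cut s x + act_cut s y.
Proof.
apply: act_cutP; rewrite mulrDr -pzscalerAr.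
by apply: act_linear; exact: act_cutE.
Qed.

Lemma act_cutD s : {morph act_cut s : x y / x + y}.
Proof. by move=> x y; have := act_cut_lin s 1 x y; rewrite !scale1r. Qed.

Lemma act_cut0 s : act_cut s 0 = 0.
Proof. by have := act_cut_lin s (-1) 0 0; rewrite scaler0 addr0 scaleN1r addNr. Qed.

Lemma act_cutM s : {morph act_cut s : x y / x * y}.
Proof.
move=> x y; apply: act_cutP.
have -> : 1_ (s^-1)%g * (x * y) = 1_ (s^-1)%g * x * (1_ (s^-1)%g * y).
  by rewrite [1_ _ * x]uidemC !mulrA -(mulrA x) uidem_idem -uidemC.
by apply: act_mul; exact: act_cutE.
Qed.

Lemma ucomp_act s x : ucomp s (act_cut s x).
Proof. by apply/ucompP; have [] := act_some (act_cutE s x). Qed.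

Lemma act_cutV s x : act_cut s (1_ (s^-1)%g * x) = act_cut s x.
Proof. by apply: act_cutP; rewrite mulrA uidem_idem act_cutE. Qed.

Lemma act_cut_comp s t x : act_cut s (act_cut t x) = act_cut (s * t)%g x.
Proof.
symmetry; apply: act_cutP.
set e := 1_ ((s * t)^-1)%g; set y := 1_ (s^-1)%g * act_cut t x.
have yw : theta s y = Some (act_cut s (act_cut t x)) by exact: act_cutE.
have [v vy] : pran (theta t) y.
  by rewrite act_ran; apply: ucomp_mull; exact: ucomp_act.
have thE u : theta (s * t)%g u = obind (theta s) (theta t u).
  by rewrite gmulfM mul_pbijE.
have vw : theta (s * t)%g v = Some (act_cut s (act_cut t x)) by rewrite thE vy.
have [ev _] := act_some vw.
have := act_cutE (s * t)%g 1; rewrite mulr1 -/e thE.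
case ep: (theta t e) => [p|//] /= ps.
have [sp _] := act_some ps; have [te _] := act_some ep.
have py : p * y = y.
  by have := act_mul ep vy; rewrite ev vy => -[].
have ex : theta t (e * x) = Some (p * act_cut t x).
  have -> : e * x = e * (1_ (t^-1)%g * x) by rewrite mulrA -uidemC te.
  exact: act_mul ep (act_cutE t x).
have pxy : p * act_cut t x = y.
  by rewrite -py /y mulrA -uidemC sp.
have := act_some ex; rewrite pxy in ex => _.
by rewrite (pfun_inj ex vy).
Qed.

Lemma act_cut_one x : act_cut 1%g x = x.
Proof.
have e1 : 1_ (1%g : S) = 1.
  suff /ucompP : ucomp 1%g 1 by rewrite mulr1.
  by rewrite /ucomp -act_ran act_one; exists 1.
apply: act_cutP.
have -> : (1^-1)%g = 1%g :> S by rewrite idemV //; exact: idem1.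
by rewrite e1 mul1r act_one.
Qed.

Lemma act_cut1 s : act_cut s 1 = 1_ s.
Proof.
have [v vs] : pran (theta s) 1_ s by rewrite act_ran; exists 1; rewrite ?mulr1.
have [ev _] := act_some vs.
have /ucompP <- := ucomp_act s 1; rewrite uidemC.
have := act_mul (act_cutE s 1) vs; rewrite mulr1 ev vs => -[].
by move=> <-.
Qed.

Lemma act_cut_idem (e : S) x : idem e -> act_cut e x = 1_ e * x.
Proof.
move=> ee; have h := act_cutE e x; rewrite (idemV ee) in h.
apply/esym/(@pfun_inj _ (theta e) _ _ (act_cut e x)) => //.
have := act_cutE e (act_cut e x); rewrite (idemV ee) act_cut_comp ee.
by have /ucompP -> := ucomp_act e x.
Qed.

Lemma uidemM s t : 1_ (s * t)%g = act_cut s 1_ t.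
Proof. by rewrite -!act_cut1 act_cut_comp. Qed.

Lemma uidem_mulgV s : 1_ (s * s^-1)%g = 1_ s.
Proof. by rewrite uidemM -[1_ _]mulr1 act_cutV act_cut1. Qed.

Lemma act_cutVK s x : act_cut s (act_cut (s^-1)%g x) = 1_ s * x.
Proof.
rewrite act_cut_comp act_cut_idem ?uidem_mulgV //; exact: idem_mulgV.
Qed.

Lemma act_cutKV s x : act_cut (s^-1)%g (act_cut s x) = 1_ (s^-1)%g * x.
Proof. by have := act_cutVK (s^-1)%g x; rewrite invgK. Qed.

(* 1_s A is contained in 1_t A if s <= t, so that a delta_t below makes sense *)
Lemma ucomp_nle s t : nle s t -> ucomp s `<=` ucomp t.
Proof.
move=> [e ee ->] a /ucompP ha; apply/ucompP; rewrite -ha uidemM act_cut_idem //.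
by rewrite [1_ e * _]uidemC !mulrA uidem_idem.
Qed.

Lemma ucomp_mul s t a b : ucomp s a -> ucomp t b -> ucomp (s * t)%g (a * act_cut s b).
Proof.
move=> sa /ucompP tb; apply/ucompP; rewrite uidemM.
by rewrite mulrA -uidemM uidemC -mulrA uidemM -act_cutM tb.
Qed.

Lemma L_mulPl s t k a a' b : ucomp s a -> ucomp s a' -> ucomp t b ->
  (k *: a + a') * act_cut s b = k *: (a * act_cut s b) + a' * act_cut s b.
Proof. by rewrite mulrDl pzscalerAl. Qed.

Lemma L_mulPr s t k a b b' : ucomp s a -> ucomp t b -> ucomp t b' ->
  a * act_cut s (k *: b + b') = k *: (a * act_cut s b) + a * act_cut s b'.
Proof. by rewrite act_cut_lin mulrDr pzscalerAr. Qed.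

Lemma L_mulA s t u a b c : ucomp s a -> ucomp t b -> ucomp u c ->
  a * act_cut s (b * act_cut t c) = a * act_cut s b * act_cut (s * t)%g c.
Proof. by rewrite act_cutM act_cut_comp mulrA. Qed.

Lemma ucomp_one : ucomp 1%g 1.
Proof. by apply/ucompP; rewrite -act_cut1 act_cut_one mulr1. Qed.

Lemma L_mul1l s a : ucomp s a -> 1 * act_cut 1%g a = a.
Proof. by rewrite mul1r act_cut_one. Qed.

Lemma L_mul1r s a : ucomp s a -> a * act_cut s 1 = a.
Proof. by move=> /ucompP sa; rewrite act_cut1 -uidemC. Qed.

(* L(A, theta, S): the product of a delta_s and b delta_t is
   a theta_s (1_(s^-1) b) delta_(st) *)
Definition L_system : gradedSystem A S :=
  @GradedSystem K A S ucomp (fun s t a b => a * act_cut s b) 1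
    ucomp0 ucomp_lin ucomp_mul L_mulPl L_mulPr L_mulA ucomp_one L_mul1l L_mul1r.

Definition L_alg : pzAlgType K := graded_alg L_system.

Definition L_delta s a : L_alg := gdelta L_system s a.

Definition N_generators : set L_alg :=
  [set x | exists s t a, [/\ nle s t, ucomp s a & x = L_delta s a - L_delta t a]].

Definition crossed_product : pzAlgType K := quot_alg N_generators.

(* the class of a delta_s, for a in 1_s A *)
Definition crossed_delta s a : crossed_product := quot_pi N_generators (L_delta s a).

Local Notation "[ s ]" := (sigma_class s).

(* D_g, the sum of the ideals 1_s A for s in g *)
Definition Dcomp (g : max_group_image S) : set A :=
  [set a | exists2 r : seq (S * A),
     (forall p, p \in r -> [p.1] = g /\ ucomp p.1 p.2) &
     a = \sum_(p <- r) p.2].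

Definition ttheta_graph (g : max_group_image S) a b : Prop :=
  exists r : seq (S * A),
    [/\ (forall p, p \in r -> [p.1] = g /\ ucomp (p.1^-1)%g p.2),
        a = \sum_(p <- r) p.2 & b = \sum_(p <- r) act_app p.1 p.2].

(* The map from D_(g^-1) to D_g; its value outside D_(g^-1) is 0.  See
   ttheta_graph_fun for its being well defined *)
Definition ttheta (g : max_group_image S) a : A := xget 0 (ttheta_graph g a).

Definition ttheta_inv (g : max_group_image S) b : A :=
  xget 0 [set a | Dcomp (g^-1)%g a /\ ttheta g a = b].

Lemma Dcomp_ind g (P : A -> Prop) : P 0 ->
  (forall a b, Dcomp g a -> Dcomp g b -> P a -> P b -> P (a + b)) ->
  (forall s a, [s] = g -> ucomp s a -> P a) -> forall a, Dcomp g a -> P a.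
Proof.
move=> P0 PD Ps _ [r hr ->]; elim: r hr => [|p r IH] hr; first by rewrite big_nil.
have [pg pa] := hr p (mem_head _ _).
have hr' q : q \in r -> [q.1] = g /\ ucomp q.1 q.2.
  by move=> qr; apply: hr; rewrite inE qr orbT.
rewrite big_cons; apply: PD; [| by exists r | exact: Ps pa | exact: IH].
by exists [:: p] => [q|]; rewrite ?big_seq1 // inE => /eqP ->.
Qed.

Lemma Dcomp0 g : Dcomp g 0.
Proof. by exists [::]; rewrite ?big_nil. Qed.

Lemma Dcomp1 s a : ucomp s a -> Dcomp [s] a.
Proof.
by move=> sa; exists [:: (s, a)] => [p|]; rewrite ?big_seq1 // inE => /eqP ->.
Qed.

Lemma ttheta_graph_lin g k a b a' b' :
  ttheta_graph g a b -> ttheta_graph g a' b' ->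
  ttheta_graph g (k *: a + a') (k *: b + b').
Proof.
move=> [r [hr -> ->]] [r' [hr' -> ->]].
exists ([seq (p.1, k *: p.2) | p <- r] ++ r'); split.
- move=> p; rewrite mem_cat => /orP[/mapP[q qr ->] /=|/hr' //].
  have [qg qa] := hr q qr; split=> //.
  by rewrite -[_ *: _]addr0; apply: ucomp_lin => //; exact: ucomp0.
- by rewrite big_cat big_map scaler_sumr.
rewrite big_cat big_map scaler_sumr; congr (_ + _) => /=.
rewrite big_seq [RHS]big_seq; apply: eq_bigr => p pr.
have [_ pa] := hr p pr; have pk : ucomp (p.1^-1)%g (k *: p.2).
  by rewrite -[_ *: _]addr0; apply: ucomp_lin => //; exact: ucomp0.
rewrite -!act_cut_id //; have := act_cut_lin p.1 k p.2 0.
by rewrite act_cut0 !addr0.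
Qed.

Lemma ttheta_graph0 g : ttheta_graph g 0 0.
Proof. by exists [::]; rewrite !big_nil. Qed.

Lemma ttheta_graph1 s a : ucomp (s^-1)%g a -> ttheta_graph [s] a (act_cut s a).
Proof.
move=> sa; rewrite act_cut_id //; exists [:: (s, a)]; rewrite !big_seq1; split=> // p.
by rewrite inE => /eqP ->.
Qed.

Lemma Dcomp_lin g k a b : Dcomp g a -> Dcomp g b -> Dcomp g (k *: a + b).
Proof.
move=> [r hr ->] [r' hr' ->].
exists ([seq (p.1, k *: p.2) | p <- r] ++ r') => [p|].
  rewrite mem_cat => /orP[/mapP[q qr ->] /=|/hr' //].
  have [qg qa] := hr q qr; split=> //.
  by rewrite -[_ *: _]addr0; apply: ucomp_lin => //; exact: ucomp0.
by rewrite big_cat big_map scaler_sumr.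
Qed.

Lemma DcompD g a b : Dcomp g a -> Dcomp g b -> Dcomp g (a + b).
Proof. by move=> Da Db; rewrite -[a]scale1r; exact: Dcomp_lin. Qed.

Lemma Dcomp_mulr g a b : Dcomp g a -> Dcomp g (a * b).
Proof.
move=> Da; elim/Dcomp_ind: a / Da => [|a a' _ _ h h'|s a <- sa].
- by rewrite mul0r; exact: Dcomp0.
- by rewrite mulrDl; exact: DcompD.
by apply: Dcomp1; exact: ucomp_mulr.
Qed.

Lemma ttheta_graph_dom g a b : ttheta_graph g a b -> Dcomp (g^-1)%g a.
Proof.
move=> [r [hr -> _]]; exists [seq ((p.1^-1)%g, p.2) | p <- r]; last by rewrite big_map.
by move=> q /mapP[p /hr[<- pa] ->]; rewrite sigma_classV.
Qed.

Lemma ttheta_graph_ex g a : Dcomp (g^-1)%g a -> exists b, ttheta_graph g a b.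
Proof.
move=> Da; elim/Dcomp_ind: a / Da => [|a a' _ _ [b h] [b' h']|s a sg sa].
- by exists 0; exact: ttheta_graph0.
- by exists (b + b'); have := ttheta_graph_lin 1 h h'; rewrite !scale1r.
exists (act_cut (s^-1)%g a).
have -> : g = [(s^-1)%g] by rewrite sigma_classV sg invgK.
by apply: ttheta_graph1; rewrite invgK.
Qed.

Lemma ttheta_graph_inv g a b : ttheta_graph g a b -> ttheta_graph (g^-1)%g b a.
Proof.
move=> [r [hr -> ->]]; exists [seq ((p.1^-1)%g, act_app p.1 p.2) | p <- r]; split.
- move=> q /mapP[p /hr[<- pa] ->] /=; rewrite sigma_classV invgK; split=> //.
  by rewrite -act_cut_id //; exact: ucomp_act.
- by rewrite big_map.
rewrite big_map /= big_seq [RHS]big_seq; apply: eq_bigr => p pr /=.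
have [_ pa] := hr p pr; rewrite -(act_cut_id pa).
rewrite -act_cut_id; last by rewrite invgK; exact: ucomp_act.
by rewrite act_cutKV; symmetry; exact/ucompP.
Qed.

Lemma ttheta_graph_ran g a b : ttheta_graph g a b -> Dcomp g b.
Proof. by move=> /ttheta_graph_inv/ttheta_graph_dom; rewrite invgK. Qed.

Lemma Dcomp_sep g a : Dcomp g a -> (forall s, [s] = g -> 1_ s * a = 0) -> a = 0.
Proof.
move=> [r hr ea] h.
suff [c ca cr] : exists2 c, c * a = a & forall p, p \in r -> c * p.2 = 0.
  by rewrite -ca ea mulr_sumr big_seq big1.
elim: r hr {ea} => [|p r IH] hr; first by exists 1; rewrite ?mul1r.
have [q qr|c ca cr] := IH; first by apply: hr; rewrite inE qr orbT.
have [pg /ucompP pa] := hr p (mem_head _ _).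
exists (c * (1 - 1_ p.1)); first by rewrite -mulrA mulrBl mul1r h // subr0.
move=> q; rewrite inE => /orP[/eqP ->|/cr qr].
  by rewrite -mulrA mulrBl mul1r pa subrr mulr0.
by rewrite -mulrA mulrBl mul1r uidemC mulrBr mulrA qr mul0r subr0.
Qed.

Section Compatible.
Hypothesis Htheta : compatible_action.

Lemma compat_cut s t x : sigma s t ->
  act_cut t (1_ (s^-1)%g * x) = act_cut s (1_ (t^-1)%g * x).
Proof.
move=> st; apply: (Htheta (sigma_sym st) (act_cutE _ _)).
by rewrite mulrA [1_ _ * 1_ _]uidemC -mulrA act_cutE.
Qed.

Lemma compat_local s t a : sigma s t -> ucomp (s^-1)%g a ->
  1_ t * act_cut s a = act_cut t a.
Proof.
move=> st /ucompP sa.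
rewrite -[in RHS]sa (compat_cut _ st) act_cutM -uidemM.
suff -> : 1_ (s * t^-1)%g = 1_ t * 1_ s.
  by rewrite -mulrA; congr (_ * _); apply/esym/ucompP; exact: ucomp_act.
have f1 : 1_ t * 1_ (s * t^-1)%g = 1_ (s * t^-1)%g.
  apply/ucompP; rewrite uidemM.
  by have := compat_cut 1 st; rewrite !mulr1 => <-; exact: ucomp_act.
have f2 : 1_ s * 1_ (s * t^-1)%g = 1_ (s * t^-1)%g.
  by apply/ucompP; rewrite uidemM; exact: ucomp_act.
have f3 : 1_ (s * t^-1)%g * (1_ s * 1_ t) = 1_ s * 1_ t.
  apply/ucompP; rewrite -act_cutVK.
  have := compat_cut 1 (sigmaV st); rewrite !invgK !mulr1 => <-.
  by rewrite act_cut_comp; exact: ucomp_act.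
by rewrite [1_ t * _]uidemC -f3 [RHS]uidemC -mulrA f1 f2.
Qed.

Lemma ttheta_graph_local g a b t : ttheta_graph g a b -> [t] = g ->
  1_ t * b = act_cut t a.
Proof.
move=> [r [hr -> ->]] tg.
rewrite mulr_sumr (big_morph _ (act_cutD t) (act_cut0 t)).
rewrite big_seq [RHS]big_seq; apply: eq_bigr => p /hr[pg pa].
by rewrite -act_cut_id // compat_local //; apply/sigma_classP; rewrite pg.
Qed.

Lemma ttheta_graph_fun g a b b' :
  ttheta_graph g a b -> ttheta_graph g a b' -> b = b'.
Proof.
move=> h h'; apply/eqP; rewrite -subr_eq0; apply/eqP; apply: (@Dcomp_sep g).
  rewrite addrC -scaleN1r.
  by apply: Dcomp_lin; [exact: ttheta_graph_ran h' | exact: ttheta_graph_ran h].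
move=> s sg; rewrite mulrBr (ttheta_graph_local h sg) (ttheta_graph_local h' sg).
exact: subrr.
Qed.

Lemma ttheta_graph_injective g a a' b :
  ttheta_graph g a b -> ttheta_graph g a' b -> a = a'.
Proof.
by move=> /ttheta_graph_inv h /ttheta_graph_inv h'; exact: ttheta_graph_fun h h'.
Qed.

Lemma tthetaE g a b : ttheta_graph g a b -> ttheta g a = b.
Proof.
by move=> h; apply: (ttheta_graph_fun _ h); apply: xgetPex; exists b.
Qed.

Lemma ttheta_invE g a b : ttheta_graph g a b -> ttheta_inv g b = a.
Proof.
move=> h; have [] : [set a | Dcomp (g^-1)%g a /\ ttheta g a = b] (ttheta_inv g b).
  by apply: xgetPex; exists a; split; [exact: ttheta_graph_dom h | exact: tthetaE].
move=> /ttheta_graph_ex[c hc]; rewrite (tthetaE hc) => cb.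
by rewrite cb in hc; exact: ttheta_graph_injective hc h.
Qed.

Definition skew_mul (g h : max_group_image S) a b : A := ttheta g (ttheta_inv g a * b).

Lemma skew_mulE g h a a' b c :
  ttheta_graph g a' a -> ttheta_graph g (a' * b) c -> skew_mul g h a b = c.
Proof. by move=> ha hc; rewrite /skew_mul (ttheta_invE ha); exact: tthetaE. Qed.

Lemma Dcomp_graph g a : Dcomp g a -> exists a', ttheta_graph g a' a.
Proof.
move=> Da; have [|a' h] := @ttheta_graph_ex (g^-1)%g a; first by rewrite invgK.
by exists a'; rewrite -(invgK g); exact: ttheta_graph_inv.
Qed.

Lemma graph_mulr g a a' b : ttheta_graph g a' a -> exists c, ttheta_graph g (a' * b) c.
Proof.
by move=> h; apply: ttheta_graph_ex; apply: Dcomp_mulr; exact: ttheta_graph_dom h.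
Qed.

Lemma skew_mul_ucomp s h a b : ucomp s a -> skew_mul [s] h a b = a * act_cut s b.
Proof.
move=> sa; have /ucompP sa' := sa.
have sVa : ucomp (s^-1)%g (act_cut (s^-1)%g a) by exact: ucomp_act.
apply: (@skew_mulE _ _ _ (act_cut (s^-1)%g a)).
  by rewrite -[X in ttheta_graph _ _ X]sa' -act_cutVK; exact: ttheta_graph1.
rewrite -[X in X * act_cut s b]sa' -act_cutVK -act_cutM.
by apply: ttheta_graph1; exact: ucomp_mulr.
Qed.

Lemma skew_mulPl g h k a a' b : Dcomp g a -> Dcomp g a' -> Dcomp h b ->
  skew_mul g h (k *: a + a') b = k *: skew_mul g h a b + skew_mul g h a' b.
Proof.
move=> /Dcomp_graph[x hx] /Dcomp_graph[x' hx'] _.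
have [c hc] := graph_mulr b hx; have [c' hc'] := graph_mulr b hx'.
rewrite (skew_mulE h hx hc) (skew_mulE h hx' hc').
apply: skew_mulE (ttheta_graph_lin k hx hx') _.
by rewrite mulrDl -pzscalerAl; exact: ttheta_graph_lin.
Qed.

Lemma skew_mulPr g h k a b b' : Dcomp g a -> Dcomp h b -> Dcomp h b' ->
  skew_mul g h a (k *: b + b') = k *: skew_mul g h a b + skew_mul g h a b'.
Proof.
move=> /Dcomp_graph[x hx] _ _.
have [c hc] := graph_mulr b hx; have [c' hc'] := graph_mulr b' hx.
rewrite (skew_mulE h hx hc) (skew_mulE h hx hc').
apply: (skew_mulE _ hx).
by rewrite mulrDr -pzscalerAr; exact: ttheta_graph_lin.
Qed.

Lemma skew_mulDl g h a a' b : Dcomp g a -> Dcomp g a' ->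
  skew_mul g h (a + a') b = skew_mul g h a b + skew_mul g h a' b.
Proof.
move=> /Dcomp_graph[x hx] /Dcomp_graph[x' hx'].
have [c hc] := graph_mulr b hx; have [c' hc'] := graph_mulr b hx'.
rewrite (skew_mulE h hx hc) (skew_mulE h hx' hc').
have H := ttheta_graph_lin 1 hx hx'; have H' := ttheta_graph_lin 1 hc hc'.
by rewrite !scale1r in H H'; apply: (skew_mulE _ H); rewrite mulrDl.
Qed.

Lemma skew_mulDr g h a b b' : Dcomp g a ->
  skew_mul g h a (b + b') = skew_mul g h a b + skew_mul g h a b'.
Proof.
move=> /Dcomp_graph[x hx].
have [c hc] := graph_mulr b hx; have [c' hc'] := graph_mulr b' hx.
rewrite (skew_mulE h hx hc) (skew_mulE h hx hc').
apply: (skew_mulE _ hx); rewrite mulrDr.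
by have := ttheta_graph_lin 1 hc hc'; rewrite !scale1r.
Qed.

Lemma skew_mul0l g h b : skew_mul g h 0 b = 0.
Proof.
apply: (skew_mulE _ (ttheta_graph0 g)); rewrite mul0r; exact: ttheta_graph0.
Qed.

Lemma skew_mul0r g h a : Dcomp g a -> skew_mul g h a 0 = 0.
Proof.
move=> /Dcomp_graph[x hx]; apply: (skew_mulE _ hx).
by rewrite mulr0; exact: ttheta_graph0.
Qed.

Lemma Dcomp_mul g h a b : Dcomp g a -> Dcomp h b -> Dcomp (g * h)%g (skew_mul g h a b).
Proof.
move=> Da Db; elim/Dcomp_ind: a / Da => [|a a' Da Da' IH IH'|s a <- sa].
- by rewrite skew_mul0l; exact: Dcomp0.
- by rewrite skew_mulDl //; exact: DcompD.
rewrite skew_mul_ucomp //.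
elim/Dcomp_ind: b / Db => [|b b' _ _ IH IH'|t b <- tb].
- by rewrite act_cut0 mulr0; exact: Dcomp0.
- by rewrite act_cutD mulrDr; exact: DcompD.
by rewrite -sigma_classM; apply: Dcomp1; exact: ucomp_mul.
Qed.

Lemma skew_mulA g h k a b c : Dcomp g a -> Dcomp h b -> Dcomp k c ->
  skew_mul g (h * k)%g a (skew_mul h k b c) =
  skew_mul (g * h)%g k (skew_mul g h a b) c.
Proof.
move=> Da Db Dc; elim/Dcomp_ind: a / Da => [|a a' Da Da' IH IH'|s a <- sa].
- by rewrite !skew_mul0l.
- by rewrite !skew_mulDl ?IH ?IH' //; exact: Dcomp_mul.
rewrite (skew_mul_ucomp (h * k)%g _ sa) (skew_mul_ucomp h _ sa).
elim/Dcomp_ind: b / Db => [|b b' Db Db' IH IH'|t b <- tb].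
- by rewrite skew_mul0l act_cut0 mulr0 skew_mul0l.
- have Dcut x : Dcomp h x -> Dcomp ([s] * h)%g (a * act_cut s x).
    by move=> Dx; rewrite -(skew_mul_ucomp h) //; apply: Dcomp_mul => //; exact: Dcomp1.
  rewrite skew_mulDl // !act_cutD !mulrDr skew_mulDl ?IH ?IH' //; exact: Dcut.
rewrite skew_mul_ucomp // -sigma_classM skew_mul_ucomp; last exact: ucomp_mul.
by rewrite act_cutM act_cut_comp mulrA.
Qed.

Lemma Dcomp_one : Dcomp 1%g 1.
Proof. by rewrite -sigma_class1; apply: Dcomp1; exact: ucomp_one. Qed.

Lemma skew_mul1l g a : Dcomp g a -> skew_mul 1%g g 1 a = a.
Proof.
by move=> _; rewrite -(sigma_class1 S) skew_mul_ucomp ?mul1r ?act_cut_one //; exact: ucomp_one.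
Qed.

Lemma skew_mul1r g a : Dcomp g a -> skew_mul g 1%g a 1 = a.
Proof.
move=> Da; elim/Dcomp_ind: a / Da => [|a a' Da Da' IH IH'|s a <- sa].
- by rewrite skew_mul0l.
- by rewrite skew_mulDl // IH IH'.
by rewrite skew_mul_ucomp // (L_mul1r sa).
Qed.

End Compatible.

Definition skew_system (Htheta : compatible_action) : gradedSystem A (max_group_image S) :=
  @GradedSystem K A (max_group_image S) Dcomp skew_mul 1
    Dcomp0 Dcomp_lin (Dcomp_mul Htheta) (skew_mulPl Htheta) (skew_mulPr Htheta)
    (skew_mulA Htheta) Dcomp_one (skew_mul1l Htheta) (skew_mul1r Htheta).

Definition skew_group_algebra (Htheta : compatible_action) : pzAlgType K :=
  graded_alg (skew_system Htheta).

Definition skew_delta (Htheta : compatible_action) g a : skew_group_algebra Htheta :=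
  gdelta (skew_system Htheta) g a.

End CrossedProduct.

Arguments N_generators {K A S} theta _.

(* Main.v *)
Require Import Defs.
From HB Require Import structures.
From mathcomp Require Import all_boot all_algebra.
From mathcomp Require Import boolp classical_sets functions cardinality.

(** The map a delta_s |-> a delta_[s] on homogeneous elements extends by
    linearity to L(A, theta, S).  It is multiplicative because for a in 1_s A the
    product a delta_[s] * b delta_[t] of the skew group algebra is
    a theta_s(1_(s^-1) b) delta_[st].  As s <= t implies [s] = [t], it kills the
    generators of N and so factors through the quotient; it is onto because every
    element of D_g is a sum of elements of the 1_s A with s in g. *)

Set Implicit Arguments.
Unset Strict Implicit.
Unset Printing Implicit Defensive.

Import GRing.Theory.
Local Open Scope ring_scope.

(* galg_ind with the operations of graded_alg D in place of those of gradedAlg D: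
   the two are convertible but not syntactically equal *)
Lemma graded_alg_ind (K : pzRingType) (A : lmodType K) (M : monoidType)
    (D : gradedSystem A M) (P : graded_alg D -> Prop) :
  P 0 -> (forall x y, P x -> P y -> P (x + y)) ->
  (forall m a, gcomp D m a -> P (gdelta D m a)) -> forall x, P x.
Proof. exact: galg_ind. Qed.

Section GradedLift.
Variables (K : pzRingType) (A : lmodType K) (M : monoidType).
Variable D : gradedSystem A M.
Variables (B : pzAlgType K) (F : M -> A -> B).
Hypothesis F_lin : forall m k a b, gcomp D m a -> gcomp D m b ->
  F m (k *: a + b) = k *: F m a + F m b.

Definition graded_lift (x : graded_alg D) : B :=
  \sum_(m <- gsupp (x : gradedAlg D)) F m (gcoef x m).

Lemma graded_lift_hom0 m : F m 0 = 0.
Proof.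
(* With [k = -1] and both arguments [0], linearity reads [F m 0 = - F m 0 + F m 0]. *)
have D0 := gcomp0 D m; have := F_lin (- 1) D0 D0.
by rewrite scaler0 addr0 scaleN1r addNr.
Qed.

Lemma graded_lift_is_linear : linear graded_lift.
Proof.
move=> k x y; rewrite /graded_lift.
(* The three supports may differ, so all sums are taken over one list [r] containing them; the extra
   terms vanish since [F m 0 = 0]. *)
pose r := undup (gsupp (x : gradedAlg D) ++ gsupp (y : gradedAlg D) ++
                 gsupp (k *: x + y : gradedAlg D)).
have ur : uniq r by exact: undup_uniq.
rewrite !(gsupp_sum (F := F) ur _ graded_lift_hom0).
- rewrite scaler_sumr -big_split; apply: eq_bigr => m _.
  by rewrite gcoefD gcoefZ F_lin //; exact: gcoef_comp.
- by move=> m; rewrite mem_undup !mem_cat => ->; rewrite orbT.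
- by move=> m; rewrite mem_undup mem_cat => ->.
by move=> m; rewrite mem_undup !mem_cat => ->; rewrite !orbT.
Qed.

HB.instance Definition _ :=
  GRing.isLinear.Build K (graded_alg D) B _ graded_lift graded_lift_is_linear.

Lemma graded_lift_delta m a : gcomp D m a -> graded_lift (gdelta D m a) = F m a.
Proof.
move=> Da; rewrite /graded_lift.
rewrite (gsupp_sum (F := F) _ (gsupp_delta Da) graded_lift_hom0) // big_seq1.
by rewrite gdeltaE // eqxx.
Qed.

(** Both sides of the product rule are additive in each factor, so homogeneous factors suffice. *)
Lemma graded_lift_monoid_morphism :
  F 1%g (gone D) = 1 ->
  (forall m n a b, gcomp D m a -> gcomp D n b ->
    F (m * n)%g (gmul D m n a b) = F m a * F n b) ->
  GRing.monoid_morphism graded_lift.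
Proof.
move=> F1 FM; split.
  by rewrite -F1; apply: graded_lift_delta; exact: gcomp_one.
move=> x y; elim/graded_alg_ind: x => [|x x' h h'|m a Da].
- by rewrite mul0r linear0 mul0r.
- by rewrite mulrDl !linearD /= h h' mulrDl.
elim/graded_alg_ind: y => [|y y' h h'|n b Db].
- by rewrite mulr0 linear0 mulr0.
- by rewrite mulrDr !linearD /= h h' mulrDr.
rewrite -[_ * _]/(galg_mul _ _) gdelta_mul // !graded_lift_delta ?FM //.
exact: gcomp_mul.
Qed.

End GradedLift.

Section QuotientLift.
Variables (K : pzRingType) (A B : pzAlgType K) (X : set A).
Variable f : {linear A -> B}.
Hypothesis f_mor : GRing.monoid_morphism f.
Hypothesis fX : forall x, X x -> f x = 0.

(** The kernel of [f] is a two-sided ideal containing [X], and [ideal_gen X] lies in every such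
    ideal. *)
Lemma ideal_gen_ker x : ideal_gen X x -> f x = 0.
Proof.
move/(_ [set x | f x = 0]%classic); apply; split=> //.
have [_ fM] := f_mor; split=> [|y z fy fz|a y fy]; rewrite /= ?linear0 //.
  by rewrite linearB fy fz subrr.
by rewrite !fM fy mulr0 mul0r.
Qed.

(** Independence of the chosen representative is [quot_liftE]. *)
Definition quot_lift (x : quot_alg X) : B := f (quot_repr x).

Lemma quot_liftE x : quot_lift (quot_pi X x) = f x.
Proof.
apply/eqP; rewrite -subr_eq0 -linearB; apply/eqP/ideal_gen_ker.
exact: quot_repr_sub.
Qed.

Lemma quot_lift_is_linear : linear quot_lift.
Proof.
move=> k x y; have [x' <-] := quot_piS x; have [y' <-] := quot_piS y.
have -> : k *: (quot_pi X x' : quot_alg X) + quot_pi X y' = quot_pi X (k *: x' + y').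
  by rewrite quot_piD -quot_piZ.
by rewrite !quot_liftE linearP.
Qed.

Lemma quot_lift_monoid_morphism : GRing.monoid_morphism quot_lift.
Proof.
have [f1 fM] := f_mor; split; first by rewrite -f1 -quot_liftE.
move=> x y; have [x' <-] := quot_piS x; have [y' <-] := quot_piS y.
by rewrite -[_ * _]/(quot_mul _ _) quot_piM !quot_liftE fM.
Qed.

End QuotientLift.

Section CrossedToSkew.
Variables (K : comPzRingType) (A : pzAlgType K) (S : inverseMonoidType).
Variables (theta : unital_action A S) (Htheta : compatible_action theta).
Local Notation B := (skew_group_algebra Htheta).

Let F (s : S) (a : A) : B := skew_delta Htheta (sigma_class s) a.

Lemma skew_delta_class_linear s k a b : ucomp theta s a -> ucomp theta s b ->
  F s (k *: a + b) = k *: F s a + F s b.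
Proof. by move=> sa sb; apply: gdeltaP; exact: Dcomp1. Qed.

Lemma skew_delta_classM s t a b : ucomp theta s a -> ucomp theta t b ->
  F (s * t)%g (a * act_cut theta s b) = F s a * F t b.
Proof.
move=> sa tb; rewrite -[RHS]/(galg_mul _ _) gdelta_mul; try exact: Dcomp1.
by rewrite /= skew_mul_ucomp // /F sigma_classM.
Qed.

Lemma skew_algebra_ind (P : B -> Prop) :
  P 0 -> (forall x y, P x -> P y -> P (x + y)) ->
  (forall s a, ucomp theta s a -> P (F s a)) -> forall y, P y.
Proof.
move=> P0 PD PF y; elim/graded_alg_ind: y => //= g a Da.
elim/Dcomp_ind: a / Da => [|a b Da Db Pa Pb|s a <- sa]; last exact: PF.
  by rewrite gdelta0.
(* Since [gdelta] is [0] outside [D_g], its additivity requires both [Da] and [Db]. *)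
have := gdeltaP (D := skew_system Htheta) 1 Da Db.
by rewrite !scale1r => ->; exact: PD.
Qed.

Definition L_to_skew : L_alg theta -> B := @graded_lift K A S (L_system theta) B F.

HB.instance Definition _ := GRing.isLinear.Build K (L_alg theta) B _ L_to_skew
  (graded_lift_is_linear (D := L_system theta) skew_delta_class_linear).

Lemma L_to_skew_delta s a : ucomp theta s a ->
  L_to_skew (L_delta theta s a) = F s a.
Proof.
exact: (graded_lift_delta (D := L_system theta) skew_delta_class_linear).
Qed.

Lemma L_to_skew_monoid_morphism : GRing.monoid_morphism L_to_skew.
Proof.
(* The unit condition holds by computation: the class of [1] is by definition the unit of the
   group. *)
apply: (graded_lift_monoid_morphism (D := L_system theta) skew_delta_class_linear) => //.
exact: skew_delta_classM.
Qed.

Lemma L_to_skew_N x : N_generators theta x -> L_to_skew x = 0.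
Proof.
(* [ta] ensures that [L_delta theta t a] is the genuine [a delta_t] and not the default [0]. *)
move=> [s [t [a [st sa ->]]]]; have ta := ucomp_nle st sa.
rewrite linearB /= !L_to_skew_delta // /F.
by have /sigma_classP -> := nle_sigma st; rewrite subrr.
Qed.

End CrossedToSkew.

Theorem proposition2p12 (K : comPzRingType) (A : pzAlgType K)
    (S : inverseMonoidType) (theta : unital_action A S)
    (Htheta : compatible_action theta) :
  exists Phi : {linear crossed_product theta -> skew_group_algebra Htheta},
    [/\ GRing.monoid_morphism Phi,
        (forall y : skew_group_algebra Htheta, exists x, Phi x = y) &
        forall (s : S) (a : A), ucomp theta s a ->
          Phi (crossed_delta theta s a) = skew_delta Htheta (sigma_class s) a].
Proof.
have mor := L_to_skew_monoid_morphism Htheta.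
have kills x := @L_to_skew_N K A S theta Htheta x.
pose Phi0 := @quot_lift K _ _ (N_generators theta) (L_to_skew Htheta).
(* Linearity depends on the proofs [mor] and [kills], so the structure is packed here. *)
pose Phi : {linear crossed_product theta -> skew_group_algebra Htheta} :=
  HB.pack Phi0 (GRing.isLinear.Build K (crossed_product theta) _ _ Phi0
    (quot_lift_is_linear mor kills)).
have PhiE s a : ucomp theta s a ->
    Phi (crossed_delta theta s a) = skew_delta Htheta (sigma_class s) a.
  by move=> sa; rewrite -L_to_skew_delta //; exact: quot_liftE mor kills _.
exists Phi; split=> //; first exact: quot_lift_monoid_morphism.
(* The image of [Phi] is closed under sums and contains every [a delta_[s]] with [a] in [1_s A];
   these generate the target additively. *)
elim/skew_algebra_ind => [|_ _ [x <-] [y <-]|s a sa].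
- by exists 0; rewrite linear0.
- by exists (x + y); rewrite linearD.
by exists (crossed_delta theta s a); exact: PhiE.
Qed.
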